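(* Let $A\in\mathbb{R}^{d\times d}$ be (symmetric) positive semidefinite, $f^*\in\mathbb{R}$, $q^*\in\mathbb{R}^d$, and $f(q)=f^*+\frac12 (q-q^* )^T A (q-q^* )$ for $q\in\mathbb{R}^d$. Let $r\ge 2$ be real, $h>0$, let $(q_k)_{k\ge 0}$ be the iterates of HB$r$ applied to $f$ with step-size $h^2$ (as defined in the context), and let $p_k:=(q_k-q_{k-1})/h$. For $k\ge 0$ define $$V_k = 2(k+r-2)^2h^2\,(f(q_k)-f^* ) + \|h(k-1)p_k+(r-1)(q_k-q^* )\|^2 - h^2(k+r-2)\,\langle \nabla f(q_k),\, h(k-1)p_k+(r-1)(q_k-q^* )\rangle .$$ Then: (1) If $h^2\le \frac{4}{\lambda_{\max}(A)}$, then $V_k\ge 0$ and $V_{k+1}-V_k\le 0$ for all $k\ge 0$. (2) For any $h^2<\frac{4}{\lambda_{\max}(A)}$, HB$r$ is accelerated, i.e. $f(q_k)-f^*=O(1/k^2)$ as $k\to\infty$. (3) In particular, if $h^2=\frac{2}{\lambda_{\max}(A)}$, then for all $k\ge 0$ with $k+r-2>0$, $$f(q_k)-f^*\le \frac{\lambda_{\max}(A)\,V_0}{2(k+r-2)^2}.$$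
   Context: HB$r$ (generalized Heavy-ball) with step-size $h^2$ for a differentiable $f:\mathbb{R}^d\to\mathbb{R}$: starting from $q_0\in\mathbb{R}^d$ with zero initial velocity $p_0=0$ (i.e. $q_{-1}:=q_0$), for $k\ge 0$, $$q_{k+1}=q_k+\frac{k-1}{k+r-1}(q_k-q_{k-1})-h^2\,\frac{k+\frac{r-2}{2}}{k+r-1}\,\nabla f(q_k).$$ $\langle\cdot,\cdot\rangle$ and $\|\cdot\|$ are the Euclidean inner product and norm; $\lambda_{\max}(A)$ is the largest eigenvalue of $A$. If $\lambda_{\max}(A)=0$, the bound $4/\lambda_{\max}(A)$ is read as $+\infty$; part (3) presupposes $\lambda_{\max}(A)>0$. *)

(* Defs.v *)
From HB Require Import structures.
From mathcomp Require Import all_boot all_order all_algebra.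
From mathcomp Require Import all_classical all_reals all_analysis.
Set Implicit Arguments.
Unset Strict Implicit.
Unset Printing Implicit Defensive.
Import Order.TTheory GRing.Theory Num.Theory.
Import numFieldNormedType.Exports.
Local Open Scope classical_set_scope.
Local Open Scope ring_scope.

Definition dotv (R : realType) (d : nat) (u v : 'cV[R]_d) : R :=
  \sum_(i < d) u i 0 * v i 0.

(* The library norm `|u| on matrices is the sup norm, not this one. *)
Definition norm2 (R : realType) (d : nat) (u : 'cV[R]_d) : R :=
  Num.sqrt (dotv u u).

Definition psdmx (R : realType) (d : nat) (A : 'M[R]_d) : Prop :=
  A^T = A /\ forall x : 'cV[R]_d, 0 <= (x^T *m A *m x) 0 0.

(* A symmetric A with d >= 1 has a nonempty finite set of real eigenvalues, so
   the supremum is the maximum. In dimension 0 this is sup set0 = 0. *)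
Definition lambda_max (R : realType) (d : nat) (A : 'M[R]_d) : R :=
  sup [set a | eigenvalue A a].

(* The bound 4 / lambda_max(A), read as +oo when lambda_max(A) = 0. *)
Definition step_bound (R : realType) (d : nat) (A : 'M[R]_d) : \bar R :=
  if lambda_max A == 0 then +oo%E else (4 / lambda_max A)%:E.

(* The column of partial derivatives, the library's 'D_v with v running over
   the standard basis. *)
Definition gradient (R : realType) (d : nat) (f : 'cV[R]_d -> R)
    (x : 'cV[R]_d) : 'cV[R]_d :=
  \col_(i < d) 'D_(delta_mx i 0) f x.

Definition quadratic (R : realType) (d : nat) (A : 'M[R]_d) (fstar : R)
    (qstar q : 'cV[R]_d) : R :=
  fstar + 2^-1 * ((q - qstar)^T *m A *m (q - qstar)) 0 0.

(* q is a run of the generalized Heavy-ball method HBr on f with step-size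
   h ^+ 2. The initial point q 0 is arbitrary; since 0.-1 = 0, the term q k.-1
   encodes the convention q_{-1} := q_0 (zero initial velocity) at k = 0. *)
Definition HB_iterates (R : realType) (d : nat) (r h : R)
    (f : 'cV[R]_d -> R) (q : nat -> 'cV[R]_d) : Prop :=
  forall k : nat,
    q k.+1 = q k
      + ((k%:R - 1) / (k%:R + r - 1)) *: (q k - q k.-1)
      - (h ^+ 2 * ((k%:R + (r - 2) / 2) / (k%:R + r - 1))) *: gradient f (q k).

Definition velocity (R : realType) (d : nat) (h : R) (q : nat -> 'cV[R]_d)
    (k : nat) : 'cV[R]_d :=
  h^-1 *: (q k - q k.-1).

Definition lyapunov (R : realType) (d : nat) (r h : R) (f : 'cV[R]_d -> R)
    (fstar : R) (qstar : 'cV[R]_d) (q : nat -> 'cV[R]_d) (k : nat) : R :=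
  let u := (h * (k%:R - 1)) *: velocity h q k + (r - 1) *: (q k - qstar) in
  2 * (k%:R + r - 2) ^+ 2 * h ^+ 2 * (f (q k) - fstar)
  + norm2 u ^+ 2
  - h ^+ 2 * (k%:R + r - 2) * dotv (gradient f (q k)) u.

(* Main.v *)
(* Put s = h^2, t = k + r - 2, x = q_k - qstar, g = A x, and
   u_k = (k-1)(q_k - q_{k-1}) + (r-1) x, the vector h(k-1)p_k + (r-1)(q_k - qstar).
   The recursion gives u_{k+1} = u_k - s (k+t)/2 g and
   (t+1)(q_{k+1} - qstar) = u_{k+1} + k x, whence
     V_{k+1} - V_k = - s (t^2 - k^2) (<x,g> - s/4 |g|^2),
   while completing the square gives
     V_k = |u_k - s t/2 g|^2 + s t^2 (<x,g> - s/4 |g|^2).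
   Everything follows from |g|^2 <= lambda_max <x,g>. To see that lambda_max,
   the supremum of the eigenvalues, dominates the Rayleigh quotient, let m be
   the least constant with A <= m as quadratic forms: if m - A were invertible
   it would be coercive, contradicting minimality, so m is an eigenvalue. *)
Require Import Defs.
From HB Require Import structures.
From mathcomp Require Import all_boot all_order all_algebra.
From mathcomp Require Import all_classical all_reals all_analysis.
From mathcomp Require Import ring lra.
Set Implicit Arguments.
Unset Strict Implicit.
Unset Printing Implicit Defensive.
Import Order.TTheory GRing.Theory Num.Theory.
Import numFieldNormedType.Exports.
Local Open Scope classical_set_scope.
Local Open Scope ring_scope.

(** * The Euclidean inner product *)

Lemma dotvE (R : realType) (d : nat) (u v : 'cV[R]_d) :
  dotv u v = (u^T *m v) 0 0.
Proof. by rewrite mxE; apply: eq_bigr => i _; rewrite mxE. Qed.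

Lemma dotvC (R : realType) (d : nat) (u v : 'cV[R]_d) : dotv u v = dotv v u.
Proof. by apply: eq_bigr => i _; rewrite mulrC. Qed.

Lemma dotvDr (R : realType) (d : nat) (u v w : 'cV[R]_d) :
  dotv u (v + w) = dotv u v + dotv u w.
Proof. by rewrite !dotvE mulmxDr mxE. Qed.

Lemma dotvZr (R : realType) (d : nat) (a : R) (u v : 'cV[R]_d) :
  dotv u (a *: v) = a * dotv u v.
Proof. by rewrite !dotvE -scalemxAr mxE. Qed.

Lemma dotvNr (R : realType) (d : nat) (u v : 'cV[R]_d) :
  dotv u (- v) = - dotv u v.
Proof. by rewrite -scaleN1r dotvZr mulN1r. Qed.

Lemma dotvDl (R : realType) (d : nat) (u v w : 'cV[R]_d) :
  dotv (u + v) w = dotv u w + dotv v w.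
Proof. by rewrite dotvC dotvDr !(dotvC w). Qed.

Lemma dotvZl (R : realType) (d : nat) (a : R) (u v : 'cV[R]_d) :
  dotv (a *: u) v = a * dotv u v.
Proof. by rewrite dotvC dotvZr dotvC. Qed.

Lemma dotvNl (R : realType) (d : nat) (u v : 'cV[R]_d) :
  dotv (- u) v = - dotv u v.
Proof. by rewrite dotvC dotvNr dotvC. Qed.

Lemma dotv0 (R : realType) (d : nat) (u : 'cV[R]_d) : dotv u 0 = 0.
Proof. by rewrite -(scale0r u) dotvZr mul0r. Qed.

Definition dotv_linear :=
  (dotvDl, dotvDr, dotvZl, dotvZr, dotvNl, dotvNr).

Lemma dotv_ge0 (R : realType) (d : nat) (u : 'cV[R]_d) : 0 <= dotv u u.
Proof. by apply: sumr_ge0 => i _; rewrite -expr2 sqr_ge0. Qed.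

Lemma dotv_eq0 (R : realType) (d : nat) (u : 'cV[R]_d) :
  (dotv u u == 0) = (u == 0).
Proof.
apply/eqP/eqP => [u0|->]; last exact: dotv0.
apply/colP => i; rewrite mxE.
have /eqP := @psumr_eq0P R _ _ (fun i => u i 0 * u i 0)
  (fun i _ => sqr_ge0 (u i 0)) u0 i isT.
by rewrite mulf_eq0 orbb => /eqP.
Qed.

(** * Forms of symmetric and positive semidefinite matrices *)

Lemma dotv_symmx (R : realType) (d : nat) (A : 'M[R]_d) (u v : 'cV[R]_d) :
  A^T = A -> dotv (A *m u) v = dotv u (A *m v).
Proof. by move=> AT; rewrite !dotvE trmx_mul AT mulmxA. Qed.

Lemma dotv_psd (R : realType) (d : nat) (A : 'M[R]_d) (u : 'cV[R]_d) :
  psdmx A -> 0 <= dotv u (A *m u).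
Proof. by move=> [_ /(_ u)]; rewrite dotvE mulmxA. Qed.

(** Nonnegativity of the form on all [a *: u + b *: v] gives the discriminant bound; [y = 0] is
    treated apart since the form may degenerate. *)
Lemma psd_cauchy_schwarz (R : realType) (d : nat) (A : 'M[R]_d)
    (u v : 'cV[R]_d) : psdmx A ->
  dotv u (A *m v) ^+ 2 <= dotv u (A *m u) * dotv v (A *m v).
Proof.
move=> psdA; have AT := psdA.1.
have vu : dotv v (A *m u) = dotv u (A *m v) by rewrite -dotv_symmx // dotvC.
have quad (a b : R) : 0 <= a ^+ 2 * dotv u (A *m u)
    + 2 * a * b * dotv u (A *m v) + b ^+ 2 * dotv v (A *m v).
  have := dotv_psd (a *: u + b *: v) psdA.
  rewrite mulmxDr -!scalemxAr !dotv_linear vu.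
  by congr (0 <= _); ring.
set x := dotv u (A *m u) in quad *; set y := dotv v (A *m v) in quad *.
set z := dotv u (A *m v) in quad *.
have y0 : 0 <= y by exact: dotv_psd.
have [y_eq0|yN0] := eqVneq y 0.
  have [->|zN0] := eqVneq z 0; first by rewrite y_eq0 mulr0 expr0n.
  (* With [y = 0] and [a = 1] the form is [x + 2 * b * z], affine in [b]; this [b] brings it to
     -1. *)
  have := quad 1 (- (x + 1) / (2 * z)); rewrite y_eq0.
  have -> : 1 ^+ 2 * x + 2 * 1 * (- (x + 1) / (2 * z)) * z
     + (- (x + 1) / (2 * z)) ^+ 2 * 0 = - 1 by field.
  by rewrite ler0N1.
have y_gt0 : 0 < y by rewrite lt_def yN0.
have := quad y (- z).
have -> : y ^+ 2 * x + 2 * y * - z * z + (- z) ^+ 2 * y = y * (x * y - z ^+ 2).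
  by ring.
by rewrite pmulr_rge0 // subr_ge0.
Qed.

Lemma dotv_mx_bounded (R : realType) (d : nat) (M : 'M[R]_d) :
  exists2 C : R, 0 < C & forall u, dotv u (M *m u) <= C * dotv u u.
Proof.
(* The summand 1 keeps the constant positive even for [M = 0]. *)
exists (1 + \sum_i \sum_j `|M i j|).
  by rewrite ltr_pwDl// sumr_ge0// => i _; rewrite sumr_ge0.
move=> u; rewrite mulrDl mul1r.
apply: le_trans (_ : (\sum_i \sum_j `|M i j|) * dotv u u <= _); last first.
  by rewrite lerDr dotv_ge0.
rewrite mulr_suml; apply: ler_sum => i _.
rewrite mxE mulr_sumr mulr_suml; apply: ler_sum => j _.
have sq_le k : u k 0 ^+ 2 <= dotv u u.
  rewrite /dotv (bigD1 k) //= -expr2 lerDl sumr_ge0 // => l _.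
  by rewrite -expr2 sqr_ge0.
apply: le_trans (ler_norm _) _.
rewrite mulrCA normrM ler_wpM2l // ler_norml.
(* Both signs of 2 |u_i u_j| <= u_i^2 + u_j^2, where each square is at most |u|^2. *)
have := sq_le i; have := sq_le j.
have := sqr_ge0 (u i 0 - u j 0); have := sqr_ge0 (u i 0 + u j 0).
rewrite !sqrrD sqrrN mulrN; move: (u i 0 * _) (u i 0 ^+ 2) (u j 0 ^+ 2) => a b c.
by move=> *; apply/andP; split; lra.
Qed.

(** * Eigenvalues and the Rayleigh quotient *)

(** [eigenvalue] speaks of row vectors; symmetry allows transposing to columns. *)
Lemma symmx_eigenvalueP (R : realType) (d : nat) (A : 'M[R]_d) (a : R) :
  A^T = A ->
  reflect (exists2 u : 'cV[R]_d, A *m u = a *: u & u != 0) (eigenvalue A a).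
Proof.
move=> AT; apply: (iffP eigenvalueP) => -[v vA vN0]; exists v^T.
- by rewrite -{1}AT -trmx_mul vA linearZ.
- by rewrite trmx_eq0.
- by rewrite -{1}AT -trmx_mul vA linearZ.
- by rewrite trmx_eq0.
Qed.

Lemma unitmx_not_eigenvalue (R : realType) (d : nat) (A : 'M[R]_d) (a : R) :
  ~~ eigenvalue A a -> a%:M - A \in unitmx.
Proof.
rewrite /eigenvalue /eigenspace negbK kermx_eq0 row_free_unit => h.
by rewrite -opprB -scaleN1r unitmxZ // unitrN1.
Qed.

(* If a psd matrix B is invertible, then Cauchy-Schwarz for the form of B,
   applied to u and B^-1 u, gives |u|^4 <= <u, Bu> <u, B^-1 u>. *)
Lemma psd_unitmx_coercive (R : realType) (d : nat) (B : 'M[R]_d) :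
  psdmx B -> B \in unitmx ->
  exists2 c : R, 0 < c & forall u, c * dotv u u <= dotv u (B *m u).
Proof.
move=> psdB Bu; have [C C0 leC] := dotv_mx_bounded (invmx B).
exists C^-1; first by rewrite invr_gt0.
move=> u; rewrite mulrC ler_pdivrMr //.
have := psd_cauchy_schwarz u (invmx B *m u) psdB.
rewrite mulKVmx // (dotvC (invmx _ *m _)).
have := leC u; have := dotv_ge0 u; have := dotv_psd u psdB.
set y := dotv u (B *m u); set x := dotv u u; set z := dotv u _.
move=> y0 x0 zC xyz.
have [->|xN0] := eqVneq x 0; first by rewrite mulr_ge0 // ltW.
have x_gt0 : 0 < x by rewrite lt_def xN0.
rewrite -(ler_pM2r x_gt0) -expr2 -mulrA; apply: le_trans xyz _.
exact: ler_wpM2l.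
Qed.

Lemma rayleigh_le_lambda_max (R : realType) (d : nat) (A : 'M[R]_d)
    (u : 'cV[R]_d) : psdmx A ->
  dotv u (A *m u) <= lambda_max A * dotv u u.
Proof.
move=> psdA; have AT := psdA.1.
(* A nonzero [u] is what bounds [S] from below; in dimension 0, [S] would be all of [R]. *)
have [->|uN0] := eqVneq u 0; first by rewrite mulmx0 dotv0 mulr0.
have u_gt0 : 0 < dotv u u by rewrite lt_def dotv_eq0 uN0 dotv_ge0.
pose S := [set m : R | forall v, dotv v (A *m v) <= m * dotv v v].
have [C C0 SC] := dotv_mx_bounded A.
have S_lb : lbound S 0.
  move=> m /(_ u) le_m; have := le_trans (dotv_psd u psdA) le_m.
  by rewrite pmulr_lge0.
have infS : has_inf S by split; [exists C | exists 0].
pose m := inf S.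
have Sm : S m.
  move=> v; apply/ler_addgt0Pl => e e0.
  (* The infimum is attained: this tolerance costs at most [e] at [v], and the added 1 covers
     [v = 0]. *)
  have e'0 : 0 < e / (dotv v v + 1).
    by rewrite divr_gt0 // ltr_wpDl // dotv_ge0.
  have [m' Sm' /ltW m'_lt] := inf_adherent e'0 infS.
  apply: le_trans (Sm' v) _.
  apply: le_trans (ler_wpM2r (dotv_ge0 v) m'_lt) _.
  rewrite mulrDl addrC lerD2r mulrAC ler_pdivrMr ?ltr_wpDl ?dotv_ge0 //.
  by rewrite ler_wpM2l ?lerDl ?(ltW e0).
have eig_le a : eigenvalue A a -> a <= m.
  move=> /(symmx_eigenvalueP _ AT) [v vA vN0].
  have v_gt0 : 0 < dotv v v by rewrite lt_def dotv_eq0 vN0 dotv_ge0.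
  by have := Sm v; rewrite vA dotvZr ler_pM2r.
apply: le_trans (Sm u) _; rewrite ler_pM2r //.
(* By [eig_le] the spectrum is bounded above, so it suffices that [m] be an eigenvalue. *)
apply: ub_le_sup; first by exists m => a /eig_le.
apply: contrapT => /negP /unitmx_not_eigenvalue Bu.
have dotB v : dotv v ((m%:M - A) *m v) = m * dotv v v - dotv v (A *m v).
  by rewrite mulmxBl mul_scalar_mx !dotv_linear.
have psdB : psdmx (m%:M - A).
  split; first by rewrite linearB /= tr_scalar_mx AT.
  by move=> v; rewrite -mulmxA -dotvE dotB subr_ge0; exact: Sm.
have [c c0 cB] := psd_unitmx_coercive psdB Bu.
have /(ge_inf infS.2) : S (m - c).
  by move=> v; have := cB v; rewrite dotB; lra.
by rewrite -/m; move: c0; lra.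
Qed.

Lemma lambda_max_ge0 (R : realType) (d : nat) (A : 'M[R]_d) :
  psdmx A -> 0 <= lambda_max A.
Proof.
move=> psdA; have [[a eig_a]|noeig] := pselect (exists a, eigenvalue A a).
  have /(symmx_eigenvalueP _ psdA.1) [v vA vN0] := eig_a.
  have v_gt0 : 0 < dotv v v by rewrite lt_def dotv_eq0 vN0 dotv_ge0.
  have := le_trans (dotv_psd v psdA) (rayleigh_le_lambda_max v psdA).
  by rewrite pmulr_lge0.
(* The spectrum is empty here, as in dimension 0, and [sup] takes the value 0. *)
rewrite /lambda_max (_ : [set a | _] = set0) ?sup0 //.
by apply/seteqP; split => // a eig_a; apply: noeig; exists a.
Qed.

(** For g = Au, Cauchy-Schwarz for the form of [A] gives |g|^4 <= <u, g> <g, Ag>; the Rayleigh bound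
    at g then leaves a factor |g|^2 to cancel. *)
Lemma dotv_mulmx_le (R : realType) (d : nat) (A : 'M[R]_d) (u : 'cV[R]_d) :
  psdmx A -> dotv (A *m u) (A *m u) <= lambda_max A * dotv u (A *m u).
Proof.
move=> psdA.
have [Au0|AuN0] := eqVneq (A *m u) 0.
  have eq0 : dotv (A *m u) (A *m u) = 0 by apply/eqP; rewrite dotv_eq0 Au0.
  by rewrite eq0 mulr_ge0 ?lambda_max_ge0 ?dotv_psd.
have Au_gt0 : 0 < dotv (A *m u) (A *m u).
  by rewrite lt_def dotv_eq0 AuN0 dotv_ge0.
rewrite -(ler_pM2r Au_gt0) -expr2 {1}(dotv_symmx _ _ psdA.1).
apply: le_trans (psd_cauchy_schwarz _ _ psdA) _.
rewrite mulrC mulrAC ler_wpM2r ?dotv_psd //.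
exact: rayleigh_le_lambda_max.
Qed.

(** * The quadratic objective and its gradient *)

Lemma quadraticE (R : realType) (d : nat) (A : 'M[R]_d) (fstar : R)
    (qstar q : 'cV[R]_d) :
  quadratic A fstar qstar q - fstar
  = 2^-1 * dotv (q - qstar) (A *m (q - qstar)).
Proof. by rewrite /quadratic -mulmxA -dotvE addrC addKr. Qed.

(** The difference quotient along e is <e, Ax> + t/2 <e, Ae>, symmetry having merged the two cross
    terms. *)
Lemma gradient_quadratic (R : realType) (d : nat) (A : 'M[R]_d) (fstar : R)
    (qstar q : 'cV[R]_d) : A^T = A ->
  gradient (quadratic A fstar qstar) q = A *m (q - qstar).
Proof.
move=> AT; apply/colP => i; rewrite mxE.
set e := delta_mx i 0; set x := q - qstar.
have -> : (A *m x) i 0 = dotv e (A *m x).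
  by rewrite dotvE trmx_delta -rowE [RHS]mxE.
apply: cvg_lim => //.
have -> : dotv e (A *m x) = dotv e (A *m x) + 0 * (2^-1 * dotv e (A *m e)).
  by rewrite mul0r addr0.
have lim_affine : (fun t : R => dotv e (A *m x) + t * (2^-1 * dotv e (A *m e)))
    @ 0^' --> dotv e (A *m x) + 0 * (2^-1 * dotv e (A *m e)).
  apply: cvgD; first exact: cvg_cst.
  apply: cvgM; last exact: cvg_cst.
  exact: cvg_within.
(* The quotient need only agree with its affine form for [t != 0], since the limit is over a
   punctured neighbourhood. *)
apply: cvg_trans lim_affine; apply: near_eq_cvg; near=> t.
have t_neq0 : t != 0 by near: t; exact: nbhs_dnbhs_neq.
have quadS : quadratic A fstar qstar (t *: e + q) - quadratic A fstar qstar q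
    = t * dotv e (A *m x) + t ^+ 2 * (2^-1 * dotv e (A *m e)).
  rewrite /quadratic -!mulmxA -!dotvE -(addrA _ q) -/x.
  rewrite mulmxDr -scalemxAr; move: x => x; rewrite !dotv_linear.
  by rewrite -(dotv_symmx x e AT) (dotvC _ e); field.
transitivity (t^-1 * (t * dotv e (A *m x) + t ^+ 2 * (2^-1 * dotv e (A *m e)))).
  by field.
by rewrite -quadS.
Unshelve. all: by end_near. Qed.

(** * The Lyapunov function along the iterates *)

Definition momentum (R : realType) (d : nat) (r : R) (qstar : 'cV[R]_d)
    (q : nat -> 'cV[R]_d) (k : nat) : 'cV[R]_d :=
  (k%:R - 1) *: (q k - q k.-1) + (r - 1) *: (q k - qstar).

Lemma lyapunov_quadratic (R : realType) (d : nat) (A : 'M[R]_d) (fstar : R)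
    (qstar : 'cV[R]_d) (r h : R) (q : nat -> 'cV[R]_d) (k : nat)
    (x := q k - qstar) (u := momentum r qstar q k) :
  A^T = A -> h != 0 ->
  lyapunov r h (quadratic A fstar qstar) fstar qstar q k
  = (k%:R + r - 2) ^+ 2 * h ^+ 2 * dotv x (A *m x) + dotv u u
    - h ^+ 2 * (k%:R + r - 2) * dotv (A *m x) u.
Proof.
move=> AT h0; rewrite /lyapunov gradient_quadratic // quadraticE.
have -> : (h * (k%:R - 1)) *: velocity h q k + (r - 1) *: (q k - qstar) = u.
  by rewrite /velocity scalerA mulrAC divff // mul1r.
rewrite /norm2 sqr_sqrtr ?dotv_ge0 // -/x.
by field.
Qed.

(** The first identity regroups the definition of [momentum]; the second is the recursion multiplied
    by [k%:R + r - 1], positive since [2 <= r]. *)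
Lemma momentumS (R : realType) (d : nat) (A : 'M[R]_d) (fstar : R)
    (qstar : 'cV[R]_d) (r h : R) (q : nat -> 'cV[R]_d) (k : nat) :
  A^T = A -> 2 <= r -> HB_iterates r h (quadratic A fstar qstar) q ->
  (k%:R + r - 1) *: (q k.+1 - qstar)
    = momentum r qstar q k.+1 + k%:R *: (q k - qstar) /\
  momentum r qstar q k.+1 = momentum r qstar q k
    - (h ^+ 2 * (k%:R + (r - 2) / 2)) *: (A *m (q k - qstar)).
Proof.
move=> AT r2 /(_ k) qS; have k0 : 0 <= k%:R :> R by [].
have c0 : k%:R + r - 1 != 0 by rewrite gt_eqF //; lra.
rewrite gradient_quadratic // in qS.
rewrite /momentum /= {}qS; move: (A *m _) => g.
split; apply/colP => i; rewrite !mxE -?natr1; first by ring.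
by field.
Qed.

Lemma lyapunov_lower_bound (R : realType) (d : nat) (A : 'M[R]_d) (fstar : R)
    (qstar : 'cV[R]_d) (r h : R) (q : nat -> 'cV[R]_d) (k : nat) :
  psdmx A -> 0 < h ->
  (k%:R + r - 2) ^+ 2 * h ^+ 2 * (1 - h ^+ 2 * lambda_max A / 4)
    * dotv (q k - qstar) (A *m (q k - qstar))
  <= lyapunov r h (quadratic A fstar qstar) fstar qstar q k.
Proof.
move=> psdA h0; rewrite lyapunov_quadratic ?psdA.1 ?gt_eqF //.
have := dotv_mulmx_le (q k - qstar) psdA.
move: (q k - qstar) (momentum _ _ _ _) (k%:R + r - 2) => x u t.
move: (A *m x) (lambda_max A) => g l gg_le.
(* This is the square completed in [u]; the next factor is the weight of |g|^2 in what remains. *)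
have := dotv_ge0 (u - (h ^+ 2 * t / 2) *: g).
rewrite !dotv_linear (dotvC u g).
have : 0 <= t ^+ 2 * h ^+ 4 / 4.
  by rewrite divr_ge0 // mulr_ge0 ?sqr_ge0 ?exprn_ge0 // ltW.
move=> /(ler_wpM2l)/(_ _ _ gg_le).
lra.
Qed.

Lemma lyapunovS (R : realType) (d : nat) (A : 'M[R]_d) (fstar : R)
    (qstar : 'cV[R]_d) (r h : R) (q : nat -> 'cV[R]_d) (k : nat)
    (V := lyapunov r h (quadratic A fstar qstar) fstar qstar q)
    (x := q k - qstar) :
  A^T = A -> 2 <= r -> 0 < h ->
  HB_iterates r h (quadratic A fstar qstar) q ->
  V k.+1 - V k = - (h ^+ 2 * ((k%:R + r - 2) ^+ 2 - k%:R ^+ 2)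
    * (dotv x (A *m x) - h ^+ 2 / 4 * dotv (A *m x) (A *m x))).
Proof.
move=> AT r2 h0 HBq; rewrite /V !lyapunov_quadratic ?gt_eqF // -/x.
have [] := momentumS k AT r2 HBq.
rewrite -/x; move: x (q k.+1 - qstar) (momentum _ _ _ k.+1) (momentum _ _ _ k).
move=> x x' u' u xS uS.
have -> : k.+1%:R + r - 2 = k%:R + r - 1 :> R by rewrite -natr1; ring.
set T := k%:R + r - 1 in xS *.
(* Next T x' - u' = k x and, A being symmetric, x' disappears from V_{k+1}. *)
have -> : T ^+ 2 * h ^+ 2 * dotv x' (A *m x') + dotv u' u'
    - h ^+ 2 * T * dotv (A *m x') u'
  = h ^+ 2 * dotv (A *m (T *: x')) (T *: x' - u') + dotv u' u'.
  by rewrite -scalemxAr !dotv_linear (dotvC x'); ring.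
rewrite xS (addrAC u') subrr add0r dotvZr mulmxDr -scalemxAr !dotv_linear.
(* The <u, g> terms cancel against those of V_k because k - 2 (k + (r-2)/2) = -(k + r - 2). *)
rewrite (dotv_symmx u' x AT) uS !dotv_linear (dotvC u (A *m x)) (dotvC x).
by field.
Qed.

(** * Step-size conditions and convergence rates *)

Lemma step_bound_le (R : realType) (d : nat) (A : 'M[R]_d) (s : R) :
  psdmx A -> (s%:E <= step_bound A)%E -> 0 <= 1 - s * lambda_max A / 4.
Proof.
move=> psdA; rewrite /step_bound; have [->|lN0] := eqVneq (lambda_max A) 0.
  by rewrite mulr0 mul0r subr0.
have l_gt0 : 0 < lambda_max A by rewrite lt_def lN0 lambda_max_ge0.
by rewrite lee_fin ler_pdivlMr //; lra.
Qed.

Lemma step_bound_lt (R : realType) (d : nat) (A : 'M[R]_d) (s : R) :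
  psdmx A -> (s%:E < step_bound A)%E -> 0 < 1 - s * lambda_max A / 4.
Proof.
move=> psdA; rewrite /step_bound; have [->|lN0] := eqVneq (lambda_max A) 0.
  by rewrite mulr0 mul0r subr0.
have l_gt0 : 0 < lambda_max A by rewrite lt_def lN0 lambda_max_ge0.
by rewrite lte_fin ltr_pdivlMr //; lra.
Qed.

Lemma lyapunov_ge0 (R : realType) (d : nat) (A : 'M[R]_d) (fstar : R)
    (qstar : 'cV[R]_d) (r h : R) (q : nat -> 'cV[R]_d) (k : nat) :
  psdmx A -> 0 < h -> 0 <= 1 - h ^+ 2 * lambda_max A / 4 ->
  0 <= lyapunov r h (quadratic A fstar qstar) fstar qstar q k.
Proof.
move=> psdA h0 c0; apply: le_trans (lyapunov_lower_bound _ _ _ _ _ psdA h0).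
by rewrite mulr_ge0 ?dotv_psd // mulr_ge0 // mulr_ge0 ?sqr_ge0.
Qed.

(** Since r >= 2, (k+r-2)^2 >= k^2, and the last factor of [lyapunovS] is at least (1 - h^2
    lambda_max / 4) <x, Ax>. *)
Lemma lyapunovS_le (R : realType) (d : nat) (A : 'M[R]_d) (fstar : R)
    (qstar : 'cV[R]_d) (r h : R) (q : nat -> 'cV[R]_d)
    (V := lyapunov r h (quadratic A fstar qstar) fstar qstar q) (k : nat) :
  psdmx A -> 2 <= r -> 0 < h -> 0 <= 1 - h ^+ 2 * lambda_max A / 4 ->
  HB_iterates r h (quadratic A fstar qstar) q ->
  V k.+1 - V k <= 0.
Proof.
move=> psdA r2 h0 c0 HBq; rewrite lyapunovS ?psdA.1 //.
have k0 : 0 <= k%:R :> R by [].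
rewrite oppr_le0; apply: mulr_ge0; first apply: mulr_ge0; first exact: sqr_ge0.
  by rewrite subr_ge0 ler_sqr ?nnegrE //; lra.
have := dotv_psd (q k - qstar) psdA; have := dotv_mulmx_le (q k - qstar) psdA.
have s0 : 0 <= h ^+ 2 / 4 by rewrite divr_ge0 ?sqr_ge0.
move=> /(ler_wpM2l s0) le_gg /(mulr_ge0 c0); lra.
Qed.

(** Common source of both rates. The product form avoids dividing by [k%:R + r - 2], which vanishes
    for [k = 0], [r = 2]. *)
Lemma suboptimality_le (R : realType) (d : nat) (A : 'M[R]_d) (fstar : R)
    (qstar : 'cV[R]_d) (r h : R) (q : nat -> 'cV[R]_d) (k : nat)
    (f := quadratic A fstar qstar) :
  psdmx A -> 2 <= r -> 0 < h -> 0 <= 1 - h ^+ 2 * lambda_max A / 4 ->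
  HB_iterates r h f q ->
  2 * h ^+ 2 * (1 - h ^+ 2 * lambda_max A / 4)
    * ((k%:R + r - 2) ^+ 2 * (f (q k) - fstar))
  <= lyapunov r h f fstar qstar q 0.
Proof.
move=> psdA r2 h0 c0 HBq.
have VS := lyapunovS_le _ psdA r2 h0 c0 HBq.
have Vle : lyapunov r h f fstar qstar q k <= lyapunov r h f fstar qstar q 0.
  by elim: k => // k; apply: le_trans; rewrite -subr_le0.
apply: le_trans Vle; apply: le_trans (lyapunov_lower_bound _ _ _ _ _ psdA h0).
by rewrite quadraticE le_eqVlt; apply/orP; left; apply/eqP; field.
Qed.

Theorem theorem1 (R : realType) (d : nat) (A : 'M[R]_d) (fstar : R)
    (qstar : 'cV[R]_d) (r h : R) (q : nat -> 'cV[R]_d)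
    (f := quadratic A fstar qstar)
    (V := lyapunov r h f fstar qstar q) :
  psdmx A -> 2 <= r -> 0 < h -> HB_iterates r h f q ->
  [/\ ((h ^+ 2)%:E <= step_bound A)%E ->
        forall k : nat, 0 <= V k /\ V k.+1 - V k <= 0,
      ((h ^+ 2)%:E < step_bound A)%E ->
        (fun k : nat => f (q k) - fstar : R^o)
          =O_\oo (fun k : nat => (k%:R ^+ 2)^-1 : R^o)
    & 0 < lambda_max A -> h ^+ 2 = 2 / lambda_max A ->
        forall k : nat, 0 < k%:R + r - 2 ->
          f (q k) - fstar <= lambda_max A * V 0%N / (2 * (k%:R + r - 2) ^+ 2)].
Proof.
move=> psdA r2 h0 HBq; split.
- move=> /(step_bound_le psdA) c0 k.
  by split; [exact: lyapunov_ge0 | exact: lyapunovS_le].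
- move=> /(step_bound_lt psdA) c0.
  pose c := 2 * h ^+ 2 * (1 - h ^+ 2 * lambda_max A / 4).
  have c_gt0 : 0 < c by rewrite !mulr_gt0 ?exprn_gt0.
  have V0 : 0 <= V 0%N by apply: lyapunov_ge0 => //; exact: ltW.
  (* The added 1 makes the constant positive even if [V 0] vanishes. *)
  apply/eqO_exP; exists ((V 0%N + 1) / c).
    by rewrite divr_gt0 // ltr_wpDl.
  (* From [k = 1] on, [k%:R ^+ 2] is invertible; it is at most [(k%:R + r - 2) ^+ 2] as [2 <= r]. *)
  exists 1%N => // k /= k1.
  have k_gt0 : 0 < k%:R :> R by rewrite ltr0n.
  have f_ge0 : 0 <= f (q k) - fstar by rewrite quadraticE mulr_ge0 ?dotv_psd.
  rewrite ger0_norm // ger0_norm ?invr_ge0 ?sqr_ge0 //.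
  rewrite ler_pdivlMr ?exprn_gt0 // ler_pdivlMr //.
  apply: le_trans (_ : V 0%N <= _); last by rewrite lerDl.
  apply: le_trans (suboptimality_le k psdA r2 h0 (ltW c0) HBq).
  rewrite mulrC ler_wpM2l ?(ltW c_gt0) // mulrC ler_wpM2r //.
  by rewrite ler_sqr ?nnegrE; lra.
- move=> l_gt0 h2 k t_gt0.
  (* The constant in [suboptimality_le] thus becomes h^2 = 2 / lambda_max. *)
  have c2 : 1 - h ^+ 2 * lambda_max A / 4 = 2^-1.
    by rewrite h2; field; exact: lt0r_neq0.
  have c0 : 0 <= 1 - h ^+ 2 * lambda_max A / 4 by rewrite c2.
  have := suboptimality_le k psdA r2 h0 c0 HBq; rewrite c2 h2 => le_V.
  rewrite ler_pdivlMr ?mulr_gt0 ?exprn_gt0 //.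
  rewrite -ler_pdivrMl //; apply: le_trans le_V.
  rewrite le_eqVlt; apply/orP; left; apply/eqP; rewrite /f.
  by field; exact: lt0r_neq0.
Qed.
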